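(* Let $\alpha=(\alpha_0,\dots,\alpha_r)\in\mathbb{R}^{r+1}_+$ be a constant vector (independent of $n$), and let $Y\in\Omega_n^r$ be a random simplicial complex with respect to $\mathbb{P}_{r,\mathfrak p}$, where $\mathfrak p=(p_0,\dots,p_r)$, $p_i=n^{-\alpha_i}$. Let $k$ be an integer such that $$\psi_k(\alpha)>1\quad\text{and}\quad\phi_k(\alpha)<1.$$ Then, a.a.s., $Y$ contains no strongly connected $k$-dimensional subcomplex $S$ with $$f_0(S)>(k+1)\left[1+\frac{1-\phi_k(\alpha)}{\psi_k(\alpha)-1}\right]$$ vertices. In particular, with probability tending to one as $n\to\infty$, $Y$ has the following property: any $k$-dimensional minimal cycle $S$ contained in $Y$ must satisfy $$f_0(S)\le(k+1)\left[1+\frac{1-\phi_k(\alpha)}{\psi_k(\alpha)-1}\right].$$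
   Context: Model. Fix an integer $r\ge0$. Let $\Delta_n$ be the simplex with vertex set $\{1,\dots,n\}$, viewed as an abstract simplicial complex. For a simplicial complex $Y$, $f_i(Y)$ is the number of $i$-dimensional simplexes of $Y$; for a subcomplex $Y\subset\Delta_n$, $e_i(Y)$ is the number of $i$-dimensional external faces of $Y$, i.e. $i$-simplexes $\sigma\subset\Delta_n$ with $\sigma\not\subset Y$ but $\partial\sigma\subset Y$ (for $i=0$: vertices not in $Y$). $\Omega_n^r$ is the set of all subcomplexes $Y\subset\Delta_n$ with $\dim Y\le r$ (including the empty one). For $\mathfrak p=(p_0,\dots,p_r)$ with $0\le p_i\le 1$ the probability measure on $\Omega_n^r$ is $$\mathbb{P}_{r,\mathfrak p}(Y)=\prod_{i=0}^r p_i^{f_i(Y)}\cdot\prod_{i=0}^r(1-p_i)^{e_i(Y)},\qquad 0^0=1.$$ Notation. $\mathbb{R}_+=[0,\infty)$ and, for $k=0,\dots,r$, $$\psi_k(\alpha)=\sum_{i=0}^r\binom{k}{i}\alpha_i,\qquad \phi_k(\alpha)=\sum_{i=0}^r\binom{k}{i}\frac{\alpha_i}{i+1},$$ with $\binom{k}{i}=0$ for $i>k$ and $\binom00=1$. A simplicial complex $S$ of dimension $k$ is strongly connected if the space $S-S^{(k-2)}$ is path-connected, where $S^{(k-2)}$ is the $(k-2)$-skeleton of $S$. A $k$-dimensional minimal cycle is a $k$-dimensional simplicial complex $S$ such that $b_k(S)=1$ and $b_k(S')=0$ for any proper subcomplex $S'\subset S$, where $b_k$ is the $k$-th Betti number.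 ''A.a.s.'' (asymptotically almost surely) means with probability tending to $1$ as $n\to\infty$.
   Formalization: In the first assertion, strongly connected complexes are also required to be pure (every simplex lies in a k-simplex); otherwise, for k ≥ 2, a k-simplex together with all vertices of Y is a counterexample. *)

(* Defs.v *)
From HB Require Import structures.
From mathcomp Require Import all_boot all_order all_algebra.
From mathcomp Require Import all_classical all_reals all_analysis.
Import Order.TTheory GRing.Theory Num.Theory.
Import numFieldNormedType.Exports.

Set Implicit Arguments.
Unset Strict Implicit.
Unset Printing Implicit Defensive.

Local Open Scope ring_scope.

(** * Subcomplexes of the simplex on the vertex set ['I_n]

    A simplex is a nonempty vertex set, its dimension being one less than its
    cardinality; a subcomplex is the set of its simplexes, so that the empty
    complex is [set0]. *)

Definition is_complex (n : nat) (S : {set {set 'I_n}}) : bool :=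
  (finset.set0 \notin S) &&
  [forall s in S, forall t : {set 'I_n},
     (t != finset.set0) && (t \subset s) ==> (t \in S)].

Definition simplices (n : nat) (S : {set {set 'I_n}}) (i : nat) :
    {set {set 'I_n}} :=
  [set s in S | #|s| == i.+1]%SET.

Definition nfaces (n : nat) (S : {set {set 'I_n}}) (i : nat) : nat :=
  #|simplices S i|.

Definition ext_faces (n : nat) (S : {set {set 'I_n}}) (i : nat) :
    {set {set 'I_n}} :=
  [set s : {set 'I_n} | [&& #|s| == i.+1, s \notin S &
     [forall t : {set 'I_n},
        (t != finset.set0) && (t \proper s) ==> (t \in S)]]]%SET.

Definition nextfaces (n : nat) (S : {set {set 'I_n}}) (i : nat) : nat :=
  #|ext_faces S i|.

Definition dim_le (n : nat) (S : {set {set 'I_n}}) (k : nat) : bool :=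
  [forall s in S, #|s| <= k.+1]%N.

Definition has_dim (n : nat) (S : {set {set 'I_n}}) (k : nat) : bool :=
  dim_le S k && [exists s in S, #|s| == k.+1].

(** * The multi-parameter random complex *)

Definition Omega (n r : nat) : {set {set {set 'I_n}}} :=
  [set Y : {set {set 'I_n}} | is_complex Y && dim_le Y r]%SET.

Definition weight (R : realType) (n r : nat) (p : 'I_r.+1 -> R)
    (Y : {set {set 'I_n}}) : R :=
  (\prod_(i < r.+1) p i ^+ nfaces Y i) *
  (\prod_(i < r.+1) (1 - p i) ^+ nextfaces Y i).

Definition Prob (R : realType) (n r : nat) (p : 'I_r.+1 -> R)
    (E : {set {set 'I_n}} -> Prop) : R :=
  \sum_(Y in Omega n r | `[< E Y >]) weight p Y.

Definition aas (R : realType) (r : nat) (p : nat -> 'I_r.+1 -> R)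
    (E : forall n, {set {set 'I_n}} -> Prop) : Prop :=
  ((fun n => Prob (p n) (E n)) @ \oo --> (1 : R))%classic.

Definition psi (R : realType) (r : nat) (alpha : 'I_r.+1 -> R) (k : nat) : R :=
  \sum_(i < r.+1) 'C(k, i)%:R * alpha i.

Definition phi (R : realType) (r : nat) (alpha : 'I_r.+1 -> R) (k : nat) : R :=
  \sum_(i < r.+1) 'C(k, i)%:R * (alpha i / i.+1%:R).

(** * Strong connectivity *)

(** Barycentric coordinates: a point of the realization has as support a
    simplex of the complex. *)
Definition realization (R : realType) (n : nat) (S : {set {set 'I_n}}) :
    set 'rV[R]_n :=
  [set x : 'rV[R]_n | [/\ forall i, 0 <= x ord0 i, \sum_i x ord0 i = 1
             & [set i | x ord0 i != 0]%SET \in S]]%classic.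

Arguments realization R {n} S.

Definition path_connected (R : realType) (T : topologicalType) (A : set T) :
    Prop :=
  (forall x y : T, A x -> A y ->
    exists g : R -> T, [/\ {within `[0, 1], continuous g},
      g 0 = x, g 1 = y & g @` `[0, 1] `<=` A])%classic.

Arguments path_connected R {T} A.

(** The simplexes of dimension at most [m - 1]; with this shift the
    (k-2)-skeleton is [skeleton_lt S k.-1], empty for [k = 0] and [k = 1]. *)
Definition skeleton_lt (n : nat) (S : {set {set 'I_n}}) (m : nat) :
    {set {set 'I_n}} :=
  [set s in S | #|s| <= m]%N%SET.

Definition pure (n : nat) (S : {set {set 'I_n}}) (k : nat) : bool :=
  [forall s in S, exists t in S, (#|t| == k.+1) && (s \subset t)].

(** Purity is the usual standing convention for strong connectivity.  It cannot
    be dropped: adding isolated vertices to a [k]-simplex, [k >= 2], leaves the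
    complement of the (k-2)-skeleton unchanged. *)
Definition strongly_connected (R : realType) (n : nat)
    (S : {set {set 'I_n}}) (k : nat) : Prop :=
  [/\ is_complex S, has_dim S k, pure S k &
      path_connected R
        (realization R S `\` realization R (skeleton_lt S k.-1))%classic].

Arguments strongly_connected R {n} S k.

(** * Betti numbers and minimal cycles *)

(** The coefficient of [t] in the boundary of [s], simplexes being oriented by
    the order of their vertices. *)
Definition incidence (n : nat) (s t : {set 'I_n}) : rat :=
  \sum_(v in s | (s :\ v)%SET == t) (-1) ^+ #|[set w in s | w < v]%N%SET|.

(** The boundary map from [k]-chains to [(k-1)]-chains, acting on row vectors.
    Its target basis consists of the simplexes with [k] vertices, hence is empty
    for [k = 0]: homology is not reduced. *)
Definition boundary_mx (n : nat) (S : {set {set 'I_n}}) (k : nat) :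
    'M[rat]_(#|[set s in S | #|s| == k.+1]%SET|,
             #|[set s in S | #|s| == k]%SET|) :=
  \matrix_(i, j) incidence (enum_val i) (enum_val j).

(** Dimension of cycles minus dimension of boundaries, over the rationals; this
    is the rank of the integral homology group. *)
Definition betti (n : nat) (S : {set {set 'I_n}}) (k : nat) : nat :=
  (\rank (kermx (boundary_mx S k)) - \rank (boundary_mx S k.+1))%N.

Definition minimal_cycle (n : nat) (S : {set {set 'I_n}}) (k : nat) : Prop :=
  [/\ is_complex S, has_dim S k, betti S k = 1%N &
      forall S' : {set {set 'I_n}},
        is_complex S' -> S' \proper S -> betti S' k = 0%N].

(* Main.v *)
Require Import Defs.
From mathcomp Require Import all_boot all_order all_algebra.
From mathcomp Require Import all_classical all_reals all_analysis.
From mathcomp Require Import fintype finset.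
From mathcomp Require Import ring lra.
Import Order.TTheory GRing.Theory Num.Theory.
Import numFieldNormedType.Exports.

Set Implicit Arguments.
Unset Strict Implicit.
Unset Printing Implicit Defensive.

(** Both assertions follow from one first moment estimate on a purely
    combinatorial notion of connectivity, [facet_connected]: the graph on the
    k-simplexes of S in which two of them are joined when they share k vertices
    is connected, and S is the union of its k-simplexes.

    Growth.  Let S be facet connected and let V be a proper subset of its
    vertices containing a k-simplex.  Some k-simplex s inside V shares k
    vertices with some k-simplex t not inside V, so t has exactly one vertex v
    outside V; adding v to V adds to the part of S lying inside V at least the
    'C(k, i) i-simplexes of t through v.  Starting from one k-simplex, S
    contains for each m between k+1 and its number of vertices an m-set V
    carrying at least 'C(k+1, i+1) + (m - k - 1) 'C(k, i) simplexes of each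
    dimension i ([facet_connected_growth]).

    First moment.  The random complex Y is the largest complex inside a random
    family X of simplexes drawn independently, an i-simplex being kept with
    probability p_i ([Prob_coin]).  Hence a family T is inside Y with
    probability at most the product of the p_i ^ f_i(T).  There are at most
    n ^ m sets V of size m and 2 ^ (2 ^ m) families T of subsets of each, so
    the probability that Y contains a family T as above is at most a constant
    times n ^ e, where
      e = m - (k+1) phi - (m - k - 1) psi
        = (k+1) (1 - phi) - (m - k - 1) (psi - 1).
    This is negative exactly when m exceeds the bound of the theorem.  Taking
    for m the first integer above the bound excludes all larger complexes as
    well, since these contain a dense m-set too
    ([aas_facet_connected_bounded]).

    Strong connectivity implies facet connectivity: a splitting of the
    k-simplexes into two classes that never share k vertices disconnects the
    realization once the (k-2)-skeleton is removed, and a continuous function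
    that changes sign between the two sides without vanishing contradicts the
    intermediate value theorem ([strongly_connected_facet_connected]).

    Minimal cycles are facet connected for a homological reason, so that no
    topology is needed for them: under such a splitting the boundaries of the
    two parts of a k-cycle have no (k-1)-simplex in common, so both parts are
    cycles, and one of them is nonzero on a proper subcomplex
    ([minimal_cycle_facet_connected]). *)

Local Open Scope ring_scope.

(** * The random complex as the image of independent simplexes *)

Section RandomComplex.
Variables (R : realType) (n r : nat) (p : 'I_r.+1 -> R).
Implicit Types (s t : {set 'I_n}) (A B X Y : {set {set 'I_n}}).

(** A product over the at most one [i] with [#|s| = i.+1], so that the sets that
    are not simplexes of dimension at most [r] get probability 1. *)
Definition face_prob s : R := \prod_(i < r.+1 | #|s| == i.+1) p i.

(** The probability of [X] when every set [s] is drawn independently. *)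
Definition coin_weight X : R :=
  \prod_s (if s \in X then face_prob s else 1 - face_prob s).

Definition full_part X : {set {set 'I_n}} :=
  [set s : {set 'I_n} | [&& s != set0, (#|s| <= r.+1)%N &
     [forall t : {set 'I_n}, (t != set0) && (t \subset s) ==> (t \in X)]]]%SET.

(** Independence: expand the product over all [s] of the sum of the two
    outcomes, with the outcomes that the event forbids replaced by 0. *)
Lemma sum_coin_weight A B : [disjoint A & B] ->
  \sum_(X : {set {set 'I_n}} | (A \subset X) && [disjoint B & X]) coin_weight X =
  (\prod_(s in A) face_prob s) * \prod_(s in B) (1 - face_prob s).
Proof.
move=> dAB.
pose F s := if s \in B then 0 else face_prob s.
pose G s := if s \in A then 0 else 1 - face_prob s.
transitivity (\prod_s (F s + G s)); last first.
  rewrite (big_mkcond (mem A)) (big_mkcond (mem B)) -big_split /=.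
  apply: eq_bigr => s _; rewrite /F /G.
  case: ifPn => sB; case: ifPn => sA; rewrite ?mul1r ?mulr1 ?add0r ?addr0 //.
    by rewrite (disjointFr dAB sA) in sB.
  by rewrite addrC subrK.
rewrite bigA_distr big_mkcond /=; apply: eq_bigr => X _.
case: ifPn => [/andP[/subsetP AX dBX] | nok].
  apply: eq_bigr => s _; rewrite /F /G; case: ifPn => sX.
    by rewrite (disjointFl dBX sX).
  by case: ifPn => // /AX; rewrite (negPf sX).
apply/esym; move: nok; rewrite negb_and => /orP[/subsetPn[s sA sX]|].
  by rewrite (bigD1 s) //= (negPf sX) /G sA mul0r.
rewrite disjoint_subset => /subsetPn[s sB]; rewrite inE negbK => sX.
by rewrite (bigD1 s) //= sX /F sB mul0r.
Qed.

Lemma prod_face_prob A : \prod_(s in A) face_prob s = \prod_(i < r.+1) p i ^+ nfaces A i.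
Proof.
rewrite /face_prob (exchange_big_dep xpredT) //=; apply: eq_bigr => i _.
rewrite prodr_const; congr (_ ^+ _); apply: eq_card => s.
by rewrite !inE.
Qed.

Lemma face_probE s (i : 'I_r.+1) : #|s| = i.+1 -> face_prob s = p i.
Proof.
move=> si; rewrite /face_prob (big_pred1 i) // => j.
by rewrite si eqSS eq_sym.
Qed.

Definition low_ext_faces Y : {set {set 'I_n}} :=
  [set s : {set 'I_n} | [exists i : 'I_r.+1, s \in ext_faces Y i]]%SET.

Lemma prod_ext_faces Y :
  \prod_(s in low_ext_faces Y) (1 - face_prob s) =
  \prod_(i < r.+1) (1 - p i) ^+ nextfaces Y i.
Proof.
transitivity (\prod_(s in low_ext_faces Y)
    \prod_(i < r.+1 | s \in ext_faces Y i) (1 - p i)).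
  apply: eq_bigr => s; rewrite inE => /existsP[i si].
  have := si; rewrite inE => /and3P[/eqP ci _ _].
  rewrite (face_probE ci) (big_pred1 i) // => j.
  apply/idP/eqP => [|-> //]; rewrite inE => /and3P[/eqP cj _ _].
  by apply/val_inj; move: cj; rewrite ci => -[].
rewrite (exchange_big_dep xpredT) //=; apply: eq_bigr => i _.
rewrite prodr_const; congr (_ ^+ _); apply: eq_card => s.
by apply: andb_idl => si; rewrite inE; apply/existsP; exists i.
Qed.

Lemma full_part_sub X : full_part X \subset X.
Proof.
apply/subsetP => s; rewrite inE => /and3P[s0 _ /forallP /(_ s)].
by rewrite s0 subxx.
Qed.

Lemma full_part_Omega X : full_part X \in Omega n r.
Proof.
rewrite inE; apply/andP; split; last first.
  by apply/forall_inP => s; rewrite inE => /and3P[].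
apply/andP; split; first by rewrite inE eqxx.
apply/forall_inP => s; rewrite inE => /and3P[s0 cs /forallP sX].
apply/forallP => t; apply/implyP => /andP[t0 ts].
rewrite inE t0 (leq_trans (subset_leq_card ts) cs) /=.
apply/forallP => u; apply/implyP => /andP[u0 ut].
by apply: (implyP (sX u)); rewrite u0 (subset_trans ut ts).
Qed.

Lemma complex_face Y s t : is_complex Y -> s \in Y -> t != set0 ->
  t \subset s -> t \in Y.
Proof.
move=> /andP[_ /forall_inP cY] sY t0 ts.
by move/forallP: (cY s sY) => /(_ t); rewrite t0 ts.
Qed.

Lemma simplex_neq0 Y s : is_complex Y -> s \in Y -> s != set0.
Proof. by move=> /andP[Y0 _]; apply: contraTneq => ->. Qed.

(** This equivalence is the origin of external faces: [Y] is the full part of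
    [X] exactly when [X] contains [Y] and misses its external faces.  A
    smallest simplex of the full part outside [Y] would have its whole boundary
    in [Y], hence be an external face lying in [X]. *)
Lemma full_part_eq Y X : Y \in Omega n r ->
  (full_part X == Y) = (Y \subset X) && [disjoint low_ext_faces Y & X].
Proof.
rewrite inE => /andP[cY /forall_inP dY].
apply/eqP/andP => [XY | [/subsetP YX dEX]].
  have YX : Y \subset X by rewrite -XY full_part_sub.
  split=> //; rewrite disjoint_subset; apply/subsetP => s.
  rewrite !inE => /existsP[i]; rewrite inE => /and3P[/eqP ci sY /forallP sb].
  apply: contra sY => sX; rewrite -XY inE -card_gt0 ci /= ltn_ord.
  apply/forallP => t; apply/implyP => /andP[t0 ts].
  have [->//|tns] := eqVneq t s.
  apply: (subsetP YX); apply: (implyP (sb t)); rewrite t0 /=.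
  by rewrite properEneq tns.
apply/eqP; rewrite eqEsubset; apply/andP; split; apply/subsetP => s; last first.
  move=> sY; rewrite inE (simplex_neq0 cY sY) dY //=.
  apply/forallP => t; apply/implyP => /andP[t0 ts].
  by apply/YX/(complex_face cY sY).
have [m] := ubnP #|s|; elim: m s => // m IH s /ltnSE cs sF.
have := sF; rewrite inE => /and3P[s0 csr /forallP sX].
apply: contraT => sY.
have sx : s \in X by apply: (subsetP (full_part_sub X)).
suff : s \in low_ext_faces Y by move=> sE; rewrite (disjointFr dEX sE) in sx.
have cs1 : (#|s|.-1 < r.+1)%N by rewrite prednK // card_gt0.
rewrite inE; apply/existsP; exists (Ordinal cs1).
rewrite inE /= prednK ?card_gt0 // eqxx sY /=.
apply/forallP => t; apply/implyP => /andP[t0 ts].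
apply: IH; first exact: leq_trans (proper_card ts) cs.
have := full_part_Omega X; rewrite inE => /andP[cF _].
exact: complex_face cF sF t0 (proper_sub ts).
Qed.

(** The weight of [Y] is the total weight of the families [X] whose full part is
    [Y], so the multi-parameter measure is the image of a product measure. *)
Lemma Prob_coin (E : {set {set 'I_n}} -> Prop) : Prob p E =
  \sum_(X : {set {set 'I_n}} | `[< E (full_part X) >]) coin_weight X.
Proof.
rewrite (partition_big full_part (fun Y => (Y \in Omega n r) && `[< E Y >])) /=;
  last by move=> X EX; rewrite full_part_Omega.
apply: eq_bigr => Y /andP[oY EY].
rewrite /weight -prod_face_prob -prod_ext_faces -sum_coin_weight; last first.
  rewrite disjoint_sym disjoint_subset; apply/subsetP => s.
  by rewrite !inE => /existsP[i]; rewrite inE => /and3P[].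
apply: eq_bigl => X; rewrite -full_part_eq //.
by case: eqP => [->|]; rewrite ?EY ?andbF.
Qed.

Hypothesis p01 : forall i, 0 <= p i <= 1.

Lemma coin_weight_ge0 X : 0 <= coin_weight X.
Proof.
have f0 s : 0 <= face_prob s by apply: prodr_ge0 => i _; case/andP: (p01 i).
have f1 s : face_prob s <= 1 by apply: prodr_ile1 => i _; exact: p01.
by apply: prodr_ge0 => s _; case: ifP; rewrite ?subr_ge0.
Qed.

Lemma sum_coin_weight1 : \sum_X coin_weight X = 1.
Proof.
have := @sum_coin_weight set0 set0.
rewrite !big_set0 mulr1 => <-; last by rewrite disjoints_subset sub0set.
by apply: eq_bigl => X; rewrite sub0set disjoints_subset sub0set.
Qed.

Lemma Prob_le1 (E : {set {set 'I_n}} -> Prop) : Prob p E <= 1.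
Proof.
rewrite Prob_coin -sum_coin_weight1 [leRHS](bigID (fun X => `[<E (full_part X)>])) /=.
by rewrite lerDl sumr_ge0 // => X _; exact: coin_weight_ge0.
Qed.

Lemma Prob_le (E E' : {set {set 'I_n}} -> Prop) :
  (forall Y, Y \in Omega n r -> E Y -> E' Y) -> Prob p E <= Prob p E'.
Proof.
move=> EE'; rewrite !Prob_coin [leRHS]big_mkcond [leLHS]big_mkcond /=.
apply: ler_sum => X _; case: asboolP => [/(EE' _ (full_part_Omega X)) e' |_].
  by case: asboolP.
by case: ifP => // _; exact: coin_weight_ge0.
Qed.

(** Since the full part of [X] is inside [X], the event that it contains [T]
    forces [X] to contain [T], which has product probability. *)
Lemma Prob_union_bound (I : finType) (P : pred I) (T : I -> {set {set 'I_n}})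
    (E : {set {set 'I_n}} -> Prop) :
  (forall Y, Y \in Omega n r -> ~ E Y -> exists2 j, P j & T j \subset Y) ->
  1 - \sum_(j | P j) \prod_(i < r.+1) p i ^+ nfaces (T j) i <= Prob p E.
Proof.
move=> nE; rewrite lerBlDr -[leLHS]sum_coin_weight1 Prob_coin.
rewrite [leLHS](bigID (fun X => `[<E (full_part X)>])) /= lerD2l.
have prE j : \prod_(i < r.+1) p i ^+ nfaces (T j) i =
    \sum_(X : {set {set 'I_n}} | (T j \subset X) && [disjoint set0 & X]) coin_weight X.
  rewrite sum_coin_weight ?prod_face_prob ?big_set0 ?mulr1 //.
  by rewrite disjoint_sym disjoints_subset sub0set.
rewrite [leRHS](eq_bigr _ (fun j _ => prE j)).
rewrite (exchange_big_dep xpredT) //= [leLHS]big_mkcond /=.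
apply: ler_sum => X _; case: asboolP => [_|/(nE _ (full_part_Omega X)) [j Pj Tj]] /=.
  by rewrite sumr_ge0 // => j _; exact: coin_weight_ge0.
rewrite (bigD1 j) /=; last first.
  by rewrite Pj (subset_trans Tj (full_part_sub X)) disjoints_subset sub0set.
by rewrite lerDl sumr_ge0 // => i _; exact: coin_weight_ge0.
Qed.

End RandomComplex.

(** * Growing facet-connected complexes vertex by vertex *)

Section Growth.
Variables (n k : nat).
Implicit Types (s t V : {set 'I_n}) (S F : {set {set 'I_n}}).

(** Connectivity of the facet graph is stated as the absence of cuts; the
    inequality is an equality since [s] and [t] are distinct k-simplexes. *)
Definition facet_connected S : Prop :=
  [/\ is_complex S, has_dim S k, pure S k &
   forall F, F \proper simplices S k -> F != set0 ->
     exists s t, [/\ s \in F, t \in simplices S k, t \notin F & (k <= #|s :&: t|%SET)%N]].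

Lemma nfaces0_le S V : is_complex S -> pure S k ->
  (forall t, t \in simplices S k -> t \subset V) -> (nfaces S 0 <= #|V|)%N.
Proof.
move=> cS /forall_inP pS SV.
rewrite -[leqRHS](card_imset (mem V) (@set1_inj 'I_n)).
apply: subset_leq_card; apply/subsetP => s; rewrite inE => /andP[sS /cards1P[v sv]].
have /existsP[t /and3P[tS ct st]] := pS s sS.
apply/imsetP; exists v => //; apply: (subsetP (SV t _)).
  by rewrite inE tS.
by rewrite (subsetP st) // sv set11.
Qed.

Lemma nfaces_in_simplex S s i : is_complex S -> s \in S ->
  nfaces (S :&: powerset s)%SET i = 'C(#|s|, i.+1).
Proof.
move=> cS sS; rewrite -cards_draws; apply: eq_card => t.
rewrite !inE; case: eqP => [ct|]; rewrite ?andbF //= !andbT.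
apply: andb_idl => ts; apply: complex_face cS sS _ ts.
by rewrite -card_gt0 ct.
Qed.

(** The new simplexes counted are [v |: u] for the [i]-subsets [u] of [t :\ v]. *)
Lemma nfaces_add_vertex S V t (v : 'I_n) i : is_complex S -> t \in S ->
  v \in t -> v \notin V -> (t :\ v)%SET \subset V ->
  (nfaces (S :&: powerset V)%SET i + 'C(#|t|.-1, i) <=
   nfaces (S :&: powerset (v |: V))%SET i)%N.
Proof.
move=> cS tS vt vV tV.
pose N := [set (v |: u)%SET | u in [set u : {set 'I_n} | u \subset (t :\ v)%SET & #|u| == i]%SET]%SET.
have vu (u : {set 'I_n}) : u \subset (t :\ v)%SET -> v \notin u.
  by move=> ut; apply/negP => /(subsetP ut); rewrite !inE eqxx.
have cN : #|N| = 'C(#|t|.-1, i).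
  rewrite card_in_imset; last first.
    move=> u1 u2; rewrite !inE => /andP[u1t _] /andP[u2t _] e.
    by rewrite -(setU1K (vu _ u1t)) e setU1K // vu.
  by rewrite cards_draws (cardsD1 v t) vt.
rewrite -cN /nfaces -cardsUI [X in (_ + X)%N]eq_card0 ?addn0; last first.
  move=> s; apply/negbTE/negP; rewrite !inE => /andP[/andP[/andP[_ sV] _] /imsetP[u _ sE]].
  by move/negP: vV; apply; apply: (subsetP sV); rewrite sE setU11.
apply: subset_leq_card; apply/subsetP => s; rewrite !inE => /orP[|].
  by move=> /andP[/andP[-> sV] ->]; rewrite (subset_trans sV) // subsetUr.
move=> /imsetP[u]; rewrite inE => /andP[ut /eqP cu] ->.
rewrite cardsU1 vu // cu eqxx andbT setUS ?(subset_trans ut) // andbT.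
apply: complex_face cS tS _ _.
  by rewrite -card_gt0 cardsU1 vu.
by rewrite subUset sub1set vt (subset_trans ut) // subD1set.
Qed.

(** The cut to which connectivity is applied is between the k-simplexes inside
    the current vertex set [V] and the others.  There are others because a
    pure complex has no vertices beyond those of its k-simplexes. *)
Lemma facet_connected_growth S m : facet_connected S ->
  (k.+1 <= m)%N -> (m <= nfaces S 0)%N ->
  exists V, [/\ #|V| = m, exists2 s, s \in simplices S k & s \subset V &
    forall i, ('C(k.+1, i.+1) + (m - k.+1) * 'C(k, i) <=
               nfaces (S :&: powerset V)%SET i)%N].
Proof.
move=> [cS /andP[_ /exists_inP[s0 s0S cs0]] pS conn].
move/eqP in cs0.
have s0F : s0 \in simplices S k by rewrite inE s0S cs0 eqxx.
elim: m => // m IH; rewrite leq_eqVlt => /orP[/eqP <- _ | km mS].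
  exists s0; split=> // [|i]; first by exists s0.
  by rewrite subnn mul0n addn0 nfaces_in_simplex // cs0.
have [V [cV [s sS sV] fV]] := IH km (ltnW mS).
pose F := [set t in simplices S k | t \subset V]%SET.
have sF : s \in F by rewrite inE sS.
have pF : F \proper simplices S k.
  rewrite properE; apply/andP; split; first by apply/subsetP => t; rewrite inE => /andP[].
  apply/negP => /subsetP SF; move: mS; rewrite ltnNge -cV; case/negP.
  apply: nfaces0_le => // t /SF; by rewrite inE => /andP[].
have F0 : F != set0 by apply/set0Pn; exists s.
have [s1 [t [s1F tS tF cst]]] := conn F pF F0.
have s1V : s1 \subset V by move: s1F; rewrite inE => /andP[].
have tV : ~~ (t \subset V) by move: tF; rewrite inE tS.
have := tS; rewrite inE => /andP[tS' /eqP ct].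
have c1 : #|t :\: V|%SET = 1%N.
  apply/eqP; rewrite eqn_leq card_gt0 setD_eq0 tV andbT.
  rewrite cardsD ct leq_subLR addn1 ltnS.
  rewrite (leq_trans cst) // subset_leq_card // setIC.
  by rewrite setIS.
have /cards1P[v tv] : #|t :\: V|%SET == 1%N by rewrite c1.
have : v \in (t :\: V)%SET by rewrite tv set11.
rewrite inE => /andP[vV vt].
exists (v |: V)%SET; split.
- by rewrite cardsU1 vV cV.
- by exists s => //; rewrite (subset_trans sV) // subsetUr.
move=> i; apply: leq_trans (nfaces_add_vertex i cS tS' vt vV _); last first.
  apply/subsetP => u; rewrite !inE => /andP[uv ut]; apply: contraT => uV.
  have : u \in (t :\: V)%SET by rewrite inE uV.
  by rewrite tv inE (negPf uv).
rewrite subSn // mulSn addnCA addnC ct leq_add2r.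
exact: fV.
Qed.

End Growth.

(** * The first moment estimate *)

Lemma cvg_powR_natN (R : realType) (d : R) : 0 < d ->
  ((fun n => n%:R `^ (- d)) @ \oo --> (0 : R))%classic.
Proof.
move=> d0; apply/cvgrPdist_lt => e e0.
near=> n; rewrite sub0r normrN ger0_norm ?powR_ge0 //.
have n0 : 0 < n%:R :> R by rewrite ltr0n; near: n; exact: nbhs_infty_gt.
rewrite powRN -[ltRHS]invrK ltf_pV2 ?posrE ?invr_gt0 ?powR_gt0 //.
have -> : e^-1 = (e^-1 `^ d^-1) `^ d.
  by rewrite -powRrM mulVf ?gt_eqF // powRr1 // invr_ge0 ltW.
rewrite gt0_ltr_powR ?nnegrE ?powR_ge0 //.
near: n; exact: nbhs_infty_gtr.
Unshelve. all: by end_near. Qed.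

Lemma bin_le_expn n m : ('C(n, m) <= n ^ m)%N.
Proof.
elim: m n => [|m IH] n; first by rewrite bin0 expn0.
case: n => [//|n].
apply: leq_trans (_ : n.+1 * 'C(n, m) <= _)%N.
  by rewrite mul_bin_diag leq_pmull.
rewrite expnS leq_mul2l /=; apply: (leq_trans (IH n)).
by case: m {IH} => // m; rewrite leq_exp2r.
Qed.

Section FirstMoment.
Variables (R : realType) (r : nat) (alpha : 'I_r.+1 -> R).
Hypothesis halpha : forall i, 0 <= alpha i.
Lemma powR_natN_01 n (i : 'I_r.+1) : (0 < n)%N ->
  0 <= (n%:R : R) `^ (- alpha i) <= 1.
Proof.
move=> n0; rewrite powR_ge0 /= powRN invf_le1 ?powR_gt0 ?ltr0n //.
by rewrite -[leLHS](powRr0 n%:R) ler_powR ?ler1n.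
Qed.

Lemma aas_mono (E E' : forall n, {set {set 'I_n}} -> Prop) :
  (forall n (Y : {set {set 'I_n}}), E n Y -> E' n Y) ->
  aas (fun n i => n%:R `^ (- alpha i)) E ->
  aas (fun n i => n%:R `^ (- alpha i)) E'.
Proof.
move=> EE' cE.
apply: (@squeeze_cvgr _ _ _ _ (fun n => Prob _ (E n)) (fun=> 1)) cE _ => [|]; last first.
  exact: cvg_cst.
near=> n; have n0 : (0 < n)%N by near: n; exact: nbhs_infty_gt.
have p01 i := @powR_natN_01 n i n0.
by rewrite (Prob_le1 p01) andbT; apply: Prob_le => // Y _; exact: EE'.
Unshelve. all: by end_near. Qed.

Variable k : nat.

(** The number of i-simplexes guaranteed on m vertices by the growth argument. *)
Definition min_faces (m i : nat) : nat := ('C(k.+1, i.+1) + (m - k.+1) * 'C(k, i))%N.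

(** The term with [phi] comes from the initial k-simplex, through the identity
    'C(k+1, i+1) = (k+1) 'C(k, i) / (i+1), and each later vertex costs [psi]. *)
Lemma sum_alpha_min_faces m : (k.+1 <= m)%N ->
  \sum_(i < r.+1) alpha i * (min_faces m i)%:R =
  k.+1%:R * phi alpha k + (m%:R - k.+1%:R) * psi alpha k.
Proof.
move=> km; rewrite /phi /psi !mulr_sumr -big_split /=; apply: eq_bigr => i _.
rewrite natrD natrM natrB // mulrDr.
have -> : 'C(k.+1, i.+1)%:R = k.+1%:R * 'C(k, i)%:R / i.+1%:R :> R.
  rewrite -natrM mul_bin_diag /= natrM mulrC mulKf // pnatr_eq0 //.
have : i.+1%:R != 0 :> R by rewrite pnatr_eq0.
by move=> i0; field; rewrite addrC natr1.
Qed.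

Lemma sum_dense_pairs n m (x : R) : 0 <= x ->
  \sum_(j : {set 'I_n} * {set {set 'I_n}} | (#|j.1| == m) && (j.2 \subset powerset j.1)) x
  <= (n ^ m)%:R * (2 ^ 2 ^ m)%:R * x.
Proof.
move=> x0; rewrite -(pair_big_dep (fun V : {set 'I_n} => #|V| == m)
  (fun V (T : {set {set 'I_n}}) => T \subset powerset V) (fun _ _ => x)) /=.
have -> : \sum_(V : {set 'I_n} | #|V| == m) \sum_(T : {set {set 'I_n}} | T \subset powerset V) x =
  \sum_(V : {set 'I_n} | #|V| == m) (2 ^ 2 ^ m)%:R * x.
  apply: eq_bigr => V /eqP cV; rewrite sumr_const mulr_natl; congr (_ *+ _).
  rewrite -cV -!card_powerset; apply: eq_card => T; by rewrite inE.
rewrite sumr_const -[leLHS]mulr_natl -mulrA; apply: ler_wpM2r; first by rewrite mulr_ge0.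
rewrite ler_nat -[X in (_ <= X ^ _)%N](card_ord n).
apply: leq_trans (bin_le_expn _ _).
rewrite -card_draws; apply: eq_leq; apply: eq_card => V; by rewrite !inE.
Qed.


Lemma prod_powR_le (n : nat) (a f : nat -> nat) : (0 < n)%N ->
  (forall i : 'I_r.+1, (a i <= f i)%N) ->
  \prod_(i < r.+1) (n%:R `^ (- alpha i)) ^+ f i <=
  n%:R `^ (- \sum_(i < r.+1) alpha i * (a i)%:R).
Proof.
move=> n0 af.
have morph_powR : {morph powR n%:R : x y / x + y >-> x * y : R}.
  by move=> x y; rewrite powRD // pnatr_eq0 -lt0n n0 implybT.
rewrite -sumrN (big_morph _ morph_powR (powRr0 _)).
apply: ler_prod => i _; rewrite exprn_ge0 ?powR_ge0 //=.
rewrite -mulNr powRrM powR_mulrn ?powR_ge0 //.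
by have /andP[? ?] := powR_natN_01 i n0; apply: ler_wiXn2l.
Qed.

(** Complexes of every size above the bound are ruled out by the single size [m],
    the first integer above it; [w - m] is the exponent of decay of the expected
    number of dense [m]-sets. *)
Lemma aas_facet_connected_bounded :
  1 < psi alpha k -> phi alpha k < 1 ->
  aas (fun n i => n%:R `^ (- alpha i)) (fun n (Y : {set {set 'I_n}}) =>
    forall S : {set {set 'I_n}}, S \subset Y -> facet_connected k S ->
      (nfaces S 0)%:R <= k.+1%:R * (1 + (1 - phi alpha k) / (psi alpha k - 1))).
Proof.
move=> hpsi hphi; set bound := k.+1%:R * _.
pose m := (Num.truncn bound).+1.
have bm : bound < m%:R by exact: truncnS_gt.
have q0 : 0 <= (1 - phi alpha k) / (psi alpha k - 1).
  by rewrite divr_ge0 ?subr_ge0 ?ltW.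
have km : (k.+1 <= m)%N.
  rewrite -(ler_nat R); apply: le_trans (ltW bm).
  by rewrite ler_peMr ?ler0n // lerDl.
pose w := \sum_(i < r.+1) alpha i * (min_faces m i)%:R.
have d0 : 0 < w - m%:R.
  rewrite /w sum_alpha_min_faces //; move: bm; rewrite /bound mulrDr mulr1 mulrA.
  rewrite -ltrBrDl ltr_pdivrMr ?subr_gt0 // => bm.
  by move: bm; lra.
pose C : R := (2 ^ 2 ^ m)%:R.
apply: (@squeeze_cvgr _ _ _ _ (fun n => 1 - C * n%:R `^ (- (w - m%:R))) (fun=> 1)).
- near=> n.
  have n0 : (0 < n)%N by near: n; exact: nbhs_infty_gt.
  have p01 i := @powR_natN_01 n i n0.
  rewrite (Prob_le1 p01) andbT.
  pose dense (j : {set 'I_n} * {set {set 'I_n}}) :=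
    [&& #|j.1| == m, j.2 \subset powerset j.1 &
     [forall i : 'I_r.+1, min_faces m i <= nfaces j.2 i]%N].
  apply: le_trans (@Prob_union_bound _ _ _ _ p01 _ dense snd _ _); last first.
    move=> Y _ /existsNP[S] /not_implyP[SY] /not_implyP[cS] /negP.
    rewrite -ltNge => bS.
    have mS : (m <= nfaces S 0)%N by rewrite /m truncn_lt_nat // mulr_ge0 // addr_ge0.
    have [V [cV _ fV]] := facet_connected_growth cS km mS.
    exists (V, S :&: powerset V)%SET => /=.
      by rewrite /dense /= cV eqxx subsetIr; apply/forallP => i; exact: fV.
    by rewrite (subset_trans (subsetIl _ _)).
  rewrite lerD2l lerN2.
  apply: le_trans (_ : \sum_(j | dense j) n%:R `^ (- w) <= _).
    apply: ler_sum => -[V T] /and3P[_ _ /forallP f].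
    exact: prod_powR_le n0 f.
  apply: le_trans (_ : (n ^ m)%:R * C * n%:R `^ (- w) <= _).
    apply: le_trans (sum_dense_pairs n m (powR_ge0 _ _)).
    rewrite [leLHS]big_mkcond [leRHS]big_mkcond; apply: ler_sum => -[V T] _ /=.
    rewrite /dense /=; case: eqP; case: subsetP => //= _ _.
    by case: ifP; rewrite ?powR_ge0.
  rewrite opprB powRD ?pnatr_eq0 -?lt0n ?n0 ?implybT //.
  by rewrite powR_mulrn ?ler0n // natrX mulrA [C * _]mulrC.
- suff: ((fun n => 1 - C * n%:R `^ (- (w - m%:R))) @ \oo --> 1 - C * 0)%classic.
    by rewrite mulr0 subr0.
  apply: cvgB; first exact: cvg_cst.
  by apply: cvgM; [exact: cvg_cst | exact: cvg_powR_natN].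
- exact: cvg_cst.
Unshelve. all: by end_near. Qed.
End FirstMoment.

(** * From path connectivity to facet connectivity *)

Section Topology.
Variables (R : realType) (n k : nat).
Implicit Types (s t : {set 'I_n}) (S F : {set {set 'I_n}}) (x : 'rV[R]_n).

Definition support x : {set 'I_n} := [set i | x ord0 i != 0]%SET.

(** On points with nonnegative coordinates this vanishes exactly on the union of
    the closed simplexes of [F]; being polynomial it is continuous without any
    case distinction. *)
Definition off_family F x : R := \prod_(s in F) \sum_(i | i \notin s) x ord0 i.

Lemma off_family_continuous F : continuous (off_family F).
Proof.
apply: continuous_big; first exact: mul_continuous.
move=> s _; apply: continuous_big => [|i _]; first exact: add_continuous.
exact: coord_continuous.
Qed.

Lemma off_family_ge0 F x : (forall i, 0 <= x ord0 i) -> 0 <= off_family F x.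
Proof. by move=> x0; apply: prodr_ge0 => s _; apply: sumr_ge0 => i _. Qed.

Lemma off_family_eq0 F x : (forall i, 0 <= x ord0 i) ->
  (off_family F x == 0) = [exists s in F, support x \subset s].
Proof.
move=> x0; apply/idP/exists_inP => [|[s sF /subsetP xs]].
  move=> /prodf_eq0[s sF]; rewrite psumr_eq0 // => /allP xs; exists s => //.
  apply/subsetP => i; rewrite inE; apply: contraNT => is_.
  by have := xs i (mem_index_enum _); rewrite is_.
apply/prodf_eq0; exists s => //; rewrite big1 // => i is_; apply/eqP.
by apply: contraNT is_ => xi; apply: xs; rewrite inE.
Qed.

Definition barycenter s : 'rV[R]_n := \row_i (if i \in s then #|s|%:R^-1 else 0).

Lemma support_barycenter s : support (barycenter s) = s.
Proof.
apply/setP => i; rewrite inE mxE; case: ifPn => is_; last by rewrite eqxx.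
by rewrite invr_eq0 pnatr_eq0 -lt0n (cardD1 i) is_.
Qed.

Lemma barycenter_in_realization S s : s != set0 -> s \in S ->
  realization R S (barycenter s).
Proof.
move=> s0 sS; split; last by rewrite [X in X \in _]support_barycenter.
- by move=> i; rewrite mxE; case: ifP => // _; rewrite invr_ge0.
under eq_bigr do rewrite mxE.
rewrite -big_mkcond sumr_const -[LHS]mulr_natr mulVf //.
by rewrite pnatr_eq0 -lt0n card_gt0.
Qed.

(** If no simplex of [F] shares k vertices with one of the complementary family
    [G], then off the (k-2)-skeleton the closed simplexes of [F] and of [G] are
    disjoint.  There the difference of the two functions [off_family] never
    vanishes, while along a path from [F] to [G] it passes from negative to
    positive. *)
Lemma strongly_connected_facet_connected S : (0 < k)%N ->
  strongly_connected R S k -> facet_connected k S.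
Proof.
move=> k0 [cS dS pS pcS]; split=> // F pF /set0Pn[s sF].
apply: contrapT => nadj.
have [FS [t tS tF]] := properP pF.
pose G := (simplices S k :\: F)%SET.
have sS : s \in simplices S k := subsetP FS s sF.
pose A := (realization R S `\` realization R (skeleton_lt S k.-1))%classic.
have AP x : A x -> [/\ forall i, 0 <= x ord0 i, support x \in S & (k <= #|support x|)%N].
  move=> [[x0 x1 xS] xk]; split=> //.
  rewrite leqNgt; apply/negP => lt; apply: xk; split=> //.
  by rewrite inE xS -ltnS prednK.
have bA u : u \in simplices S k -> A (barycenter u).
  rewrite inE => /andP[uS /eqP cu]; split.
    by apply: barycenter_in_realization => //; rewrite -card_gt0 cu.
  move=> [_ _]; rewrite [X in X \in _]support_barycenter inE cu uS /=.
  by rewrite leqNgt ltnS (leq_trans (leq_pred _)).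
(* A support has at least k vertices, so it cannot lie both in a simplex of F
   and in a simplex of G. *)
have sep x : A x -> off_family F x - off_family G x != 0.
  move=> /AP[x0 xS kx]; rewrite subr_eq0; apply/negP => /eqP FG.
  have /forall_inP/(_ _ xS)/existsP[u /and3P[uS cu xu]] := pS.
  have uSk : u \in simplices S k by rewrite inE uS.
  have u0 : off_family F x = 0 /\ off_family G x = 0.
    have [uF|uF] := boolP (u \in F).
      have /eqP F0 : off_family F x == 0 by rewrite off_family_eq0 //; apply/exists_inP; exists u.
      by rewrite -FG F0.
    have /eqP G0 : off_family G x == 0.
      by rewrite off_family_eq0 //; apply/exists_inP; exists u => //; rewrite inE uF.
    by rewrite FG G0.
  case: u0 => /eqP + /eqP; rewrite !off_family_eq0 //.
  move=> /exists_inP[v vF xv] /exists_inP[w]; rewrite inE => /andP[wF wS] xw.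
  apply: nadj; exists v, w; split=> //; apply: leq_trans kx _.
  by rewrite subset_leq_card // subsetI xv.
have [g [gc g0 g1 gA]] := pcS _ _ (bA _ sS) (bA _ tS).
pose h y := off_family F (g y) - off_family G (g y).
have hc : ({within `[0, 1], continuous h})%classic.
  move=> y; apply: cvgB.
    have gy := gc y.
    apply: (cvg_comp _ _ gy (@off_family_continuous F (g y))).
  by apply: (cvg_comp _ _ (gc y) (@off_family_continuous _ (g y))).
have bge0 u i : 0 <= barycenter u ord0 i.
  by rewrite mxE; case: ifP => // _; rewrite invr_ge0.
have h0 : h 0 <= 0.
  rewrite /h g0; have /eqP -> : off_family F (barycenter s) == 0.
    by rewrite off_family_eq0 //; apply/exists_inP; exists s; rewrite ?support_barycenter.
  by rewrite sub0r oppr_le0 off_family_ge0.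
have h1 : 0 <= h 1.
  rewrite /h g1; have /eqP -> : off_family G (barycenter t) == 0.
    rewrite off_family_eq0 //; apply/exists_inP; exists t; rewrite ?support_barycenter //.
    by rewrite inE tF.
  by rewrite subr0 off_family_ge0.
have [|c c01 hc0] := @IVT R h 0 1 0 ler01 hc.
  by rewrite ge_min h0 le_max h1 orbT.
have /sep := gA (g c) (classical_sets.imageP g c01).
by rewrite -/(h c) hc0 eqxx.
Qed.

End Topology.

(** * From minimal cycles to facet connectivity *)

Section Homology.
Variables (n k : nat).
Implicit Types (s t : {set 'I_n}) (S F : {set {set 'I_n}}) (z : {set 'I_n} -> rat).

(** Nonzero k-cycles carried by [F], as functions on simplexes: unlike the row
    vectors of [boundary_mx], these can be compared between complexes. *)
Definition cycle_on F z : Prop :=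
  (exists2 s, s \in F & z s != 0) /\
  forall t, #|t| = k -> \sum_(s in F) z s * incidence s t = 0.

Lemma incidence_neq0 s t : incidence s t != 0 -> (t \subset s).
Proof.
apply: contraNT => nts; rewrite /incidence big1 // => v /andP[_ /eqP e].
by rewrite -e subD1set in nts.
Qed.

Lemma betti_top S : dim_le S k ->
  betti S k = \rank (kermx (boundary_mx S k)).
Proof.
move=> /forall_inP dS; rewrite /betti; have : (\rank (boundary_mx S k.+1) <= 0)%N.
  apply: leq_trans (rank_leq_row _) _; rewrite leqn0 cards_eq0.
  apply/eqP/setP => s; rewrite !inE; apply/negP => /andP[/dS sk /eqP cs].
  by rewrite cs ltnn in sk.
by rewrite leqn0 => /eqP ->; rewrite subn0.
Qed.

(** In the top dimension there are no boundaries, so the Betti number is the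
    dimension of the space of cycles.  For [0 < k] the coefficient of a boundary
    vanishes automatically on sets outside [S]; for [k = 0] it would not, as the
    empty set is the boundary of a vertex but never a simplex of [S]. *)
Lemma betti_neq0_cycle S : dim_le S k -> (0 < k)%N -> is_complex S ->
  betti S k != 0%N <-> exists z, cycle_on (simplices S k) z.
Proof.
move=> dS k0 cS; rewrite betti_top // mxrank_eq0.
split=> [/rowV0Pn[v vk v0] | [z [[s sS zs] zc]]].
  pose z s := \sum_(i | enum_val i == s) v ord0 i.
  have zE i : z (enum_val i) = v ord0 i.
    by rewrite /z (big_pred1 i) // => j; rewrite (inj_eq enum_val_inj).
  exists z; split.
    have [i vi] : exists i, v ord0 i != 0.
      apply/existsP; apply: contraR v0; rewrite negb_exists => /forallP h.
      by apply/eqP/rowP => i; rewrite mxE; apply/eqP; rewrite -[_ == _]negbK h.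
    by exists (enum_val i); [exact: enum_valP | rewrite zE].
  move=> t ct; have [tS|tS] := boolP (t \in [set s in S | #|s| == k]%SET).
    move: vk; rewrite sub_kermx => /eqP/rowP/(_ (enum_rank_in tS t)).
    rewrite !mxE => e; rewrite -[RHS]e [LHS]big_enum_val; apply: eq_bigr => i _.
    by rewrite zE mxE enum_rankK_in.
  apply: big1 => s; rewrite inE => /andP[sS _].
  apply/eqP; rewrite mulf_eq0; apply/orP; right.
  apply: contraNT tS => /incidence_neq0 ts.
  rewrite inE ct eqxx andbT; apply: complex_face cS sS _ ts.
  by rewrite -card_gt0 ct.
apply/rowV0Pn; exists (\row_i z (enum_val i)).
  rewrite sub_kermx; apply/eqP/rowP => j; rewrite !mxE.
  have := enum_valP j; rewrite inE => /andP[_ /eqP cj].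
  rewrite -[RHS](zc _ cj) [RHS]big_enum_val; apply: eq_bigr => i _.
  by rewrite !mxE.
apply: contra zs => /eqP/rowP/(_ (enum_rank_in sS s)).
by rewrite !mxE enum_rankK_in // => ->.
Qed.

Definition closure_of F : {set {set 'I_n}} :=
  [set t : {set 'I_n} | (t != set0) && [exists s in F, t \subset s]]%SET.

Lemma closure_complex F : is_complex (closure_of F).
Proof.
apply/andP; split; first by rewrite inE eqxx.
apply/forall_inP => s; rewrite inE => /andP[_ /exists_inP[u uF su]].
apply/forallP => t; apply/implyP => /andP[t0 ts]; rewrite inE t0.
by apply/exists_inP; exists u => //; exact: subset_trans su.
Qed.

Lemma closure_sub S F : is_complex S -> F \subset S -> closure_of F \subset S.
Proof.
move=> cS FS; apply/subsetP => t; rewrite inE => /andP[t0 /exists_inP[u uF tu]].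
by apply: complex_face cS _ t0 tu; exact: (subsetP FS).
Qed.

Lemma simplices_closure S F : F \subset simplices S k ->
  simplices (closure_of F) k = F.
Proof.
move=> /subsetP FS; apply/setP => t; rewrite !inE; apply/idP/idP.
  move=> /andP[/andP[_ /exists_inP[u uF tu]] ct].
  have := FS u uF; rewrite inE => /andP[_ /eqP cu].
  have /eqP -> // : t == u.
  by rewrite eqEcard tu cu (eqP ct) leqnn.
move=> tF; have := FS t tF; rewrite inE => /andP[_ ct]; rewrite ct andbT.
by rewrite -card_gt0 (eqP ct); apply/exists_inP; exists t.
Qed.

(** The complex spanned by the simplexes carrying a cycle has nonzero Betti
    number, so minimality leaves no room for it to be proper. *)
Lemma minimal_cycle_closure S F z : (0 < k)%N -> minimal_cycle S k ->
  F \subset simplices S k -> cycle_on F z -> closure_of F = S.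
Proof.
move=> k0 [cS _ _ minS] FS zF.
have FS' : F \subset S by apply/(subset_trans FS)/subsetP => s; rewrite inE => /andP[].
apply/eqP; apply: contraT => nS.
have := minS _ (closure_complex F).
rewrite properEneq nS closure_sub // => /(_ isT) b0.
suff : betti (closure_of F) k != 0%N by rewrite b0.
apply/betti_neq0_cycle => //; last 2 first.
- exact: closure_complex.
- by exists z; rewrite (simplices_closure FS).
apply/forall_inP => t; rewrite inE => /andP[_ /exists_inP[u uF tu]].
have := subsetP FS u uF; rewrite inE => /andP[_ /eqP <-].
exact: subset_leq_card.
Qed.

(** Given a cut of the k-simplexes with no pair sharing k vertices, every
    (k-1)-simplex is a face of one side only; the boundary of a cycle therefore
    vanishes on both sides separately. *)
Lemma minimal_cycle_facet_connected S : (0 < k)%N -> minimal_cycle S k ->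
  facet_connected k S.
Proof.
move=> k0 mS; have [cS dS b1 _] := mS; have /andP[dS' _] := dS.
have [z zS] : exists z, cycle_on (simplices S k) z.
  by apply/betti_neq0_cycle; rewrite ?b1.
have closF := minimal_cycle_closure k0 mS.
split=> //.
  apply/forall_inP => t; rewrite -{1}(closF _ _ (subxx _) zS) inE.
  move=> /andP[_ /exists_inP[u]]; rewrite inE => /andP[uS cu] tu.
  by apply/existsP; exists u; rewrite uS cu.
move=> F pF F0; apply: contrapT => nadj.
have FS := proper_sub pF.
(* If G carries a cycle then S is the complex spanned by G, whose only
   k-simplexes are those of G. *)
have noz (G : {set {set 'I_n}}) z' : G \proper simplices S k -> ~ cycle_on G z'.
  move=> pG zG; have cG := closF _ _ (proper_sub pG) zG.
  have := simplices_closure (proper_sub pG); rewrite cG => GS.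
  by rewrite -GS properxx in pG.
pose G := (simplices S k :\: F)%SET.
have pG : G \proper simplices S k.
  rewrite properEneq subsetDl andbT; apply/eqP => GS.
  have /set0Pn[s sF] := F0; have := subsetP FS s sF.
  by rewrite -GS inE sF.
have split_sum (f : {set 'I_n} -> rat) : \sum_(s in simplices S k) f s =
    \sum_(s in F) f s + \sum_(s in G) f s.
  rewrite (big_setID F) /=; congr (_ + _); apply: eq_bigl => s.
  by rewrite inE andbC; apply: andb_idr => /(subsetP FS).
case: zS => [[s sS zs] zc].
have one_side t : #|t| = k ->
  \sum_(s in F) z s * incidence s t = 0 /\ \sum_(s in G) z s * incidence s t = 0.
  move=> ct; have := zc t ct; rewrite split_sum.
  have [[u uF tu] | nF] := pselect (exists2 u, u \in F & t \subset u).
    have -> : \sum_(v in G) z v * incidence v t = 0; last by rewrite addr0.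
    apply: big1 => v; rewrite inE => /andP[vF vS].
    apply/eqP; rewrite mulf_eq0; apply/orP; right; apply: contraT => /incidence_neq0 tv.
    case: nadj; exists u, v; split=> //; rewrite -ct subset_leq_card //.
    by rewrite subsetI tu.
  have -> : \sum_(v in F) z v * incidence v t = 0; last by rewrite add0r.
  apply: big1 => v vF.
  apply/eqP; rewrite mulf_eq0; apply/orP; right; apply: contraT => /incidence_neq0 tv.
  by case: nF; exists v.
have [sF|sF] := boolP (s \in F).
  by apply: (noz F z pF); split=> [|t /one_side[]//]; exists s.
apply: (noz G z pG); split=> [|t /one_side[]//]; exists s => //.
by rewrite inE sF.
Qed.
End Homology.

(** * The vertex bound *)

Theorem theorem20 (R : realType) (r : nat) (alpha : 'I_r.+1 -> R)
    (halpha : forall i, 0 <= alpha i)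
    (k : nat) (hk : (k <= r)%N)
    (hpsi : 1 < psi alpha k) (hphi : phi alpha k < 1) :
  let p := fun (n : nat) (i : 'I_r.+1) => n%:R `^ (- alpha i) in
  let bound := k.+1%:R * (1 + (1 - phi alpha k) / (psi alpha k - 1)) in
  aas p (fun n (Y : {set {set 'I_n}}) =>
    ~ exists S : {set {set 'I_n}},
        [/\ S \subset Y, strongly_connected R S k & bound < (nfaces S 0)%:R])
  /\
  aas p (fun n (Y : {set {set 'I_n}}) =>
    forall S : {set {set 'I_n}},
      S \subset Y -> minimal_cycle S k -> (nfaces S 0)%:R <= bound).
Proof.
move=> p bound.
have k0 : (0 < k)%N.
  rewrite lt0n; apply/eqP => k0.
  (* for k = 0 only the term i = 0 is left in psi and in phi *)
  suff psi_phi : psi alpha k = phi alpha k.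
    by move: (lt_trans hphi hpsi); rewrite psi_phi ltxx.
  apply: eq_bigr => i _; rewrite k0.
  by case: (nat_of_ord i) => [|j]; rewrite ?divr1 // bin0n !mul0r.
have bounded := aas_facet_connected_bounded halpha hpsi hphi.
split; apply: (aas_mono halpha) bounded => n Y YP.
  move=> [S [SY scS]]; apply/negP; rewrite -leNgt; apply: (YP S SY).
  exact: strongly_connected_facet_connected k0 scS.
by move=> S SY mS; apply: (YP S SY); exact: minimal_cycle_facet_connected.
Qed.
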